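(* Let $\mathbb{F}$ be a division ring, $n$ a positive integer, $\sigma:\mathbb{F}\to\mathbb{F}^{n\times n}$ a ring morphism and $\delta:\mathbb{F}\to\mathbb{F}^n$ a $\sigma$-derivation. For all $\mathbf{a}\in\mathbb{F}^n$ and $F,G\in\mathbb{F}[\mathbf{x};\sigma,\delta]$, it holds that $$(FG)^{\mathcal{D}_{\mathbf{a}}}=F^{\mathcal{D}_{\mathbf{a}}}\circ G^{\mathcal{D}_{\mathbf{a}}},$$ where $\circ$ is composition of maps $\mathbb{F}\to\mathbb{F}$.
   Context: Rings are associative with identity, not necessarily commutative, and ring morphisms preserve identities. $\mathbb{F}^n$ denotes column vectors. A map $\delta:\mathbb{F}\to\mathbb{F}^n$ is a $\sigma$-derivation if $\delta(a+b)=\delta(a)+\delta(b)$ and $\delta(ab)=\sigma(a)\delta(b)+\delta(a)b$ for all $a,b\in\mathbb{F}$. Free skew polynomial ring: let $\mathcal{M}$ be the free monoid on pairwise distinct variables $x_1,\dots,x_n$. $\mathbb{F}[\mathbf{x};\sigma,\delta]$ is the left $\mathbb{F}$-vector space with basis $\mathcal{M}$, with the ring product given by concatenating monomials and $x_i a=\sum_{j=1}^n\sigma_{i,j}(a)x_j+\delta_i(a)$ for $a\in\mathbb{F}$. Linearized polynomials: define $\mathcal{D}_{\mathbf{a}}:\mathbb{F}\to\mathbb{F}^n$ by $\mathcal{D}_{\mathbf{a}}(\beta)=\sigma(\beta)\mathbf{a}+\delta(\beta)$. Define maps $\mathcal{D}_{\mathbf{a}}^{\mathfrak{m}}:\mathbb{F}\to\mathbb{F}$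 for $\mathfrak{m}\in\mathcal{M}$ recursively by $\mathcal{D}_{\mathbf{a}}^{1}=\mathrm{Id}$ and $\mathcal{D}_{\mathbf{a}}^{x_i\mathfrak{m}}(\beta)=$ the $i$-th component of $\mathcal{D}_{\mathbf{a}}(\mathcal{D}_{\mathbf{a}}^{\mathfrak{m}}(\beta))$. For $F=\sum_{\mathfrak{m}}F_{\mathfrak{m}}\mathfrak{m}$ set $F^{\mathcal{D}_{\mathbf{a}}}=\sum_{\mathfrak{m}}F_{\mathfrak{m}}\mathcal{D}_{\mathbf{a}}^{\mathfrak{m}}$, a map $\mathbb{F}\to\mathbb{F}$, $\beta\mapsto\sum_{\mathfrak{m}}F_{\mathfrak{m}}\mathcal{D}_{\mathbf{a}}^{\mathfrak{m}}(\beta)$. *)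

(* Defs.v *)
From HB Require Import structures.
From mathcomp Require Import all_boot all_algebra.
From mathcomp Require Import finmap.
From mathcomp.multinomials Require Import monalg.

Set Implicit Arguments.
Unset Strict Implicit.
Unset Printing Implicit Defensive.

Import GRing.Theory.
Local Open Scope ring_scope.

(* [*m b%:M] multiplies every entry of a column by [b] on the right: over a
   noncommutative ring this differs from the left scaling [b *: _]. *)
Record skew_derivation (F : nzRingType) (n : nat)
    (sigma : {rmorphism F -> 'M[F]_n}) := SkewDerivation {
  skew_der :> F -> 'cV[F]_n;
  skew_derD : forall a b, skew_der (a + b) = skew_der a + skew_der b;
  skew_derM : forall a b,
    skew_der (a * b) = sigma a *m skew_der b + skew_der a *m b%:M }.

(* The free left F-module on the words in n letters. [malg] gets no product
   here because [seq] carries no [monomType] structure: the only product is the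
   twisted one put on this alias below. *)
Definition skewpoly (F : nzRingType) (n : nat)
    (sigma : {rmorphism F -> 'M[F]_n}) (delta : skew_derivation sigma) : Type :=
  {malg F[seq 'I_n]}.

Section MalgSum.
Context {K : choiceType} {F : nzRingType} {V : zmodType}.
Variable h : F -> K -> V.
Hypothesis hD : forall k, {morph h^~ k : a b / a + b}.

Let h0 k : h 0 k = 0.
Proof. by apply: (addIr (h 0 k)); rewrite -hD !add0r. Qed.

Lemma malg_sumD (g1 g2 : {malg F[K]}) :
  \sum_(k <- msupp (g1 + g2)) h (g1 + g2)@_k k =
  \sum_(k <- msupp g1) h g1@_k k + \sum_(k <- msupp g2) h g2@_k k.
Proof.
have widen (g : {malg F[K]}) (d : {fset K}) : fsubset (msupp g) d ->
    \sum_(k <- msupp g) h g@_k k = \sum_(k <- d) h g@_k k.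
  by move=> sgd; apply: big_fset_incl => // k _ /mcoeff_outdom ->.
rewrite (widen _ _ (msuppD_le g1 g2)) (widen g1 _ (fsubsetUl _ (msupp g2))).
rewrite (widen g2 _ (fsubsetUr (msupp g1) _)) -big_split /=.
by apply: eq_bigr => k _; rewrite mcoeffD hD.
Qed.

Lemma malg_sumU c k :
  \sum_(l <- msupp (<< c *g k >> : {malg F[K]})) h (<< c *g k >>)@_l l = h c k.
Proof.
rewrite msuppU; case: eqP => [->|_]; first by rewrite big_seq_fset0 h0.
by rewrite big_seq_fset1 mcoeffUU.
Qed.

End MalgSum.

Section SkewMul.
Context {F : nzRingType} {n : nat}.
Variables (sigma : {rmorphism F -> 'M[F]_n}) (delta : skew_derivation sigma).

Local Notation P := {malg F[seq 'I_n]}.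

(* x_i * (c m) = \sum_j sigma_ij(c) x_j m + delta_i(c) m *)
Definition skew_xterm (i : 'I_n) (c : F) (m : seq 'I_n) : P :=
  \sum_(j < n) << sigma c i j *g j :: m >> + << delta c i 0 *g m >>.

Definition skew_xmul (i : 'I_n) (G : P) : P :=
  \sum_(m <- msupp G) skew_xterm i G@_m m.

Definition skew_wmul (w : seq 'I_n) (G : P) : P := foldr skew_xmul G w.

Definition skew_mul (H G : P) : P :=
  \sum_(w <- msupp H) H@_w *: skew_wmul w G.

Definition skew_one : P := << [::] >>.

Lemma malg_ind (Q : P -> Prop) :
  Q 0 -> (forall c m, Q << c *g m >>) -> (forall g h, Q g -> Q h -> Q (g + h)) ->
  forall g, Q g.
Proof.
by move=> Q0 QU QD g; rewrite [g]monalgE; elim/big_ind: _ => // m _.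
Qed.

Lemma malgZU (c d : F) (m : seq 'I_n) :
  c *: (<< d *g m >> : P) = << c * d *g m >>.
Proof. by apply/malgP => k; rewrite mcoeffZ !mcoeffU mulrnAr. Qed.

Lemma skew_der0 : delta 0 = 0.
Proof. by apply: (addIr (delta 0)); rewrite -skew_derD !add0r. Qed.

Lemma skew_der1 : delta 1 = 0.
Proof.
have := skew_derM delta 1 1.
rewrite mulr1 rmorph1 mul1mx mulmx1 => e.
by apply: (addrI (delta 1)); rewrite -e addr0.
Qed.

Lemma skew_xtermD i m : {morph skew_xterm i ^~ m : a b / a + b}.
Proof.
move=> a b; rewrite /skew_xterm skew_derD mxE monalgUD addrACA -big_split /=.
by congr (_ + _); apply: eq_bigr => j _; rewrite rmorphD mxE monalgUD.
Qed.

Lemma skew_xmulD i : {morph skew_xmul i : g h / g + h}.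
Proof. by move=> g h; apply: malg_sumD => m; apply: skew_xtermD. Qed.

Lemma skew_xmulU i c m : skew_xmul i << c *g m >> = skew_xterm i c m.
Proof. by apply: malg_sumU => k; apply: skew_xtermD. Qed.

Lemma skew_xmul0 i : skew_xmul i 0 = 0.
Proof. by apply: (addIr (skew_xmul i 0)); rewrite -skew_xmulD !add0r. Qed.

Lemma skew_xmulZ i c g :
  skew_xmul i (c *: g) =
  \sum_(j < n) sigma c i j *: skew_xmul j g + delta c i 0 *: g.
Proof.
elim/malg_ind: g => [|d m|g h IHg IHh]; first last.
- rewrite scalerDr skew_xmulD IHg IHh addrACA -big_split -scalerDr /=.
  congr (_ + _); apply: eq_bigr => j _.
  by rewrite skew_xmulD scalerDr.
- rewrite malgZU skew_xmulU /skew_xterm malgZU rmorphM skew_derM mxE monalgUD addrA.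
  congr (_ + _); last first.
    by rewrite mxE big_ord_recl big_ord0 addr0 mxE eqxx mulr1n.
  under [in RHS]eq_bigr => j _.
    rewrite skew_xmulU /skew_xterm scalerDr scaler_sumr malgZU.
    under eq_bigr => k _ do rewrite malgZU.
    over.
  rewrite big_split /= exchange_big /=; congr (_ + _).
    by apply: eq_bigr => k _; rewrite mxE raddf_sum.
  by rewrite mxE raddf_sum.
- rewrite !scaler0 skew_xmul0 addr0 big1 // => j _.
  by rewrite skew_xmul0 scaler0.
Qed.

Lemma skew_wmulD w : {morph skew_wmul w : g h / g + h}.
Proof. by elim: w => [|i w IH] g h //; rewrite [LHS](congr1 (skew_xmul i) (IH g h)) skew_xmulD. Qed.

Lemma skew_wmul0 w : skew_wmul w 0 = 0.
Proof. by elim: w => //= i w ->; rewrite skew_xmul0. Qed.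

Lemma skew_wmulU w m : skew_wmul w << m >> = << w ++ m >>.
Proof.
elim: w => //= i w ->; rewrite skew_xmulU /skew_xterm skew_der1 rmorph1.
rewrite mxE monalgU0 addr0 (bigD1 i) //= mxE eqxx big1 ?addr0 // => j.
by rewrite mxE eq_sym => /negPf ->; rewrite monalgU0.
Qed.

Lemma skew_mulDl : left_distributive skew_mul +%R.
Proof.
move=> g1 g2 g; apply: (malg_sumD (h := fun c w => c *: skew_wmul w g)) => k.
by move=> a b; rewrite scalerDl.
Qed.

Lemma skew_mulDr : right_distributive skew_mul +%R.
Proof.
move=> g g1 g2; rewrite /skew_mul -big_split; apply: eq_bigr => w _ /=.
by rewrite skew_wmulD scalerDr.
Qed.

Lemma skew_mul0g g : skew_mul 0 g = 0.
Proof. by apply: (addIr (skew_mul 0 g)); rewrite -skew_mulDl !add0r. Qed.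

Lemma skew_mulU c w g : skew_mul << c *g w >> g = c *: skew_wmul w g.
Proof.
apply: (malg_sumU (h := fun c w => c *: skew_wmul w g)) => k a b.
by rewrite scalerDl.
Qed.

Lemma skew_mulZ c g h : skew_mul (c *: g) h = c *: skew_mul g h.
Proof.
elim/malg_ind: g => [|d m|g1 g2 IH1 IH2].
- by rewrite scaler0 skew_mul0g scaler0.
- by rewrite malgZU !skew_mulU scalerA.
- by rewrite scalerDr !skew_mulDl scalerDr IH1 IH2.
Qed.

Lemma skew_mul_xmul i g h : skew_mul (skew_xmul i g) h = skew_xmul i (skew_mul g h).
Proof.
elim/malg_ind: g => [|c m|g1 g2 IH1 IH2].
- by rewrite skew_xmul0 !skew_mul0g skew_xmul0.
- rewrite skew_xmulU skew_mulU skew_xmulZ /skew_xterm skew_mulDl skew_mulU.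
  congr (_ + _).
  rewrite (big_morph (skew_mul^~ h) (fun _ _ => skew_mulDl _ _ _) (skew_mul0g h)).
  by apply: eq_bigr => j _; rewrite skew_mulU.
- by rewrite skew_xmulD !skew_mulDl skew_xmulD IH1 IH2.
Qed.

Lemma skew_mul_wmul w g h : skew_mul (skew_wmul w g) h = skew_wmul w (skew_mul g h).
Proof. by elim: w => //= i w IH; rewrite skew_mul_xmul IH. Qed.

Lemma skew_mulA : associative skew_mul.
Proof.
move=> f g h; elim/malg_ind: f => [|c w|f1 f2 IH1 IH2].
- by rewrite !skew_mul0g.
- by rewrite !skew_mulU skew_mulZ skew_mul_wmul.
- by rewrite !skew_mulDl IH1 IH2.
Qed.

Lemma skew_mul1g : left_id skew_one skew_mul.
Proof. by move=> g; rewrite skew_mulU scale1r. Qed.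

Lemma skew_mulg1 : right_id skew_one skew_mul.
Proof.
move=> g; rewrite [RHS]monalgE; apply: eq_bigr => w _.
by rewrite skew_wmulU cats0 malgZU mulr1.
Qed.

Lemma skew_one_neq0 : skew_one != 0.
Proof. by rewrite monalgU_eq0 oner_eq0. Qed.

HB.instance Definition _ := Choice.on (skewpoly delta).
HB.instance Definition _ := GRing.Lmodule.on (skewpoly delta).
HB.instance Definition _ := GRing.Zmodule_isNzRing.Build (skewpoly delta)
  skew_mulA skew_mul1g skew_mulg1 skew_mulDl skew_mulDr skew_one_neq0.
HB.instance Definition _ := GRing.Lmodule_isLalgebra.Build F (skewpoly delta)
  (fun c g h => esym (skew_mulZ c g h)).

Definition skewX (i : 'I_n) : skewpoly delta := << [:: i] >>.

Lemma skewX_mulA (i : 'I_n) (c : F) :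
  skewX i * c%:A = \sum_(j < n) sigma c i j *: skewX j + (delta c i 0)%:A.
Proof.
have A (d : F) : d%:A = << d *g [::] >> :> skewpoly delta.
  by rewrite [LHS]malgZU mulr1.
rewrite !A; have -> : skewX i * << c *g [::] >> = skew_xterm i c [::].
  by rewrite [LHS]skew_mulU scale1r /= skew_xmulU.
congr (_ + _); apply: eq_bigr => j _.
by rewrite [RHS]malgZU mulr1.
Qed.

Lemma skewX_word (w : seq 'I_n) :
  \prod_(i <- w) skewX i = << w >> :> skewpoly delta.
Proof.
elim: w => [|i w IH]; first by rewrite big_nil.
rewrite big_cons IH; rewrite [LHS]skew_mulU scale1r.
exact: (skew_wmulU [:: i] w).
Qed.

Lemma skewpolyE (G : skewpoly delta) :
  G = \sum_(w <- msupp G) mcoeff w G *: \prod_(i <- w) skewX i.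
Proof.
rewrite [LHS]monalgE; apply: eq_bigr => w _.
by rewrite skewX_word [RHS]malgZU mulr1.
Qed.

Definition Dvec (a : 'cV[F]_n) (b : F) : 'cV[F]_n := sigma b *m a + delta b.

Fixpoint Dmon (a : 'cV[F]_n) (w : seq 'I_n) (b : F) : F :=
  if w is i :: w' then Dvec a (Dmon a w' b) i 0 else b.

Definition linearized (a : 'cV[F]_n) (G : skewpoly delta) (b : F) : F :=
  \sum_(w <- msupp G) mcoeff w G * Dmon a w b.

End SkewMul.

(* Main.v *)
(** For a fixed point [a], the map sending [G] to its linearized polynomial is
    left F-linear, and the twisted Leibniz rule for [delta] makes left
    multiplication by [x_i] correspond to the [i]-th component of [Dvec a].
    Hence it turns left multiplication by a word [w] into [Dmon a w]. *)
Require Import Defs.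
From mathcomp Require Import all_boot all_algebra.
From mathcomp.multinomials Require Import monalg.
Import GRing.Theory.
Local Open Scope ring_scope.

Section Linearized.
Context {F : nzRingType} {n : nat} {sigma : {rmorphism F -> 'M[F]_n}}.
Variables (delta : skew_derivation sigma) (a : 'cV[F]_n).

Local Notation lin := (@linearized F n sigma delta a).
Local Notation malg := {malg F[seq 'I_n]}.
Local Notation dvec := (@Dvec F n sigma delta a).
Local Notation dmon := (@Dmon F n sigma delta a).

Lemma DvecD (b c : F) : dvec (b + c) = dvec b + dvec c.
Proof. by rewrite /Dvec rmorphD skew_derD mulmxDl addrACA. Qed.

(** By multiplicativity of [sigma], [sigma b] factors out of [sigma (b * c) *m a] and of the first
    Leibniz term; the cofactors add up to [dvec c]. *)
Lemma DvecM (b c : F) :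
  dvec (b * c) = sigma b *m dvec c + delta b *m c%:M.
Proof. by rewrite /Dvec rmorphM skew_derM mulmxDr addrA mulmxA. Qed.

Lemma linearizedD (g h : malg) (b : F) : lin (g + h) b = lin g b + lin h b.
Proof.
apply: (malg_sumD (h := fun c w => c * dmon w b)) => w c d.
by rewrite mulrDl.
Qed.

Lemma linearizedU (c : F) (w : seq 'I_n) (b : F) :
  lin (<< c *g w >> : malg) b = c * dmon w b.
Proof.
apply: (malg_sumU (h := fun c w => c * dmon w b)) => v d e.
by rewrite mulrDl.
Qed.

Lemma linearized0 (b : F) : lin (0 : malg) b = 0.
Proof. by apply: (addIr (lin (0 : malg) b)); rewrite -linearizedD !add0r. Qed.

Lemma linearized_sum (I : Type) (r : seq I) (g : I -> malg) (b : F) :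
  lin (\sum_(i <- r) g i) b = \sum_(i <- r) lin (g i) b.
Proof.
exact: (big_morph (fun G : malg => lin G b)
  (fun g h => linearizedD g h b) (linearized0 b)).
Qed.

(** Scaling may shrink the support if [F] has zero divisors, hence the induction on [g]. *)
Lemma linearizedZ (c : F) (g : malg) (b : F) : lin (c *: g) b = c * lin g b.
Proof.
elim/(@malg_ind F n): g => [|d w|g h IHg IHh].
- by rewrite scaler0 linearized0 mulr0.
- by rewrite malgZU !linearizedU mulrA.
- by rewrite scalerDr !linearizedD IHg IHh mulrDr.
Qed.

(** On a single term with coefficient [c], row [i] of [DvecM] mirrors the rule moving [x_i] past
    [c]; additivity does the rest. *)
Lemma linearized_xmul (i : 'I_n) (g : malg) (b : F) :
  lin (skew_xmul delta i g) b = dvec (lin g b) i 0.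
Proof.
elim/(@malg_ind F n): g => [|c w|g h IHg IHh].
- by rewrite skew_xmul0 linearized0 /Dvec rmorph0 mul0mx add0r skew_der0 mxE.
- rewrite skew_xmulU linearizedD linearized_sum !linearizedU DvecM !mxE.
  (* The 1 by 1 matrix [(dmon w b)%:M] reduces to its only entry. *)
  rewrite big_ord1 mxE mulr1n; congr (_ + _).
  by apply: eq_bigr => j _; rewrite linearizedU.
- by rewrite skew_xmulD !linearizedD IHg IHh DvecD [RHS]mxE.
Qed.

Lemma linearized_wmul (w : seq 'I_n) (g : malg) (b : F) :
  lin (skew_wmul delta w g) b = dmon w (lin g b).
Proof. by elim: w => //= i w IH; rewrite linearized_xmul IH. Qed.

Lemma linearized_mul (g h : malg) (b : F) :
  lin (skew_mul delta g h) b = lin g (lin h b).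
Proof.
(* Both sides unfold to sums over the support of [g]. *)
rewrite linearized_sum; apply: eq_bigr => w _.
by rewrite linearizedZ linearized_wmul.
Qed.

End Linearized.

Theorem theorem6 (F : unitRingType)
    (F_division : forall x : F, x != 0 -> x \is a GRing.unit)
    (n : nat) (n_gt0 : (0 < n)%N)
    (sigma : {rmorphism F -> 'M[F]_n}) (delta : skew_derivation sigma)
    (a : 'cV[F]_n) (P Q : skewpoly delta) :
  linearized a (P * Q) =1 linearized a P \o linearized a Q.
(* The product of [skewpoly delta] is [skew_mul] by conversion. *)
Proof. by move=> b; exact: linearized_mul. Qed.
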